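(* All complexes of the type $\mathrm{Hom}_M(A,B)$ (for arbitrary sets $A,B$ and arbitrary sets $M$ of maps $A\to B$) with isomorphic $1$-skeletons are isomorphic to each other as polyhedral complexes. More precisely, the $1$-skeleton determines the complex in the following way: every product of simplices, whose $1$-skeleton is in the $1$-skeleton of the complex, itself belongs to the complex.
   Context: For a set $B$, $\Delta^B$ denotes the simplex with vertex set $B$ (its faces are the finite nonempty subsets of $B$). For sets $A,B$, $C(A,B)$ is the weak direct product $\prod_{x\in A}\Delta^B$: its cells are the products $\sigma=\prod_{x\in A}\sigma_x$ with each $\sigma_x$ a finite nonempty subset of $B$ (viewed as a simplex) and $\dim\sigma_x\ge 1$ for only finitely many $x$; the dimension of the cell is $\sum_{x\in A}\dim\sigma_x$, and the faces of $\sigma$ are the cells $\prod_x\tau_x$ with $\emptyset\ne\tau_x\subseteq\sigma_x$ for all $x$. For a set $M$ of maps $A\to B$, $\mathrm{Hom}_M(A,B)$ is the subcomplex of $C(A,B)$ consisting of all cells $\sigma=\prod_{x\in A}\sigma_x$ such that every map $\varphi:A\to B$ with $\varphi(x)\in\sigma_x$ for all $x\in A$ belongs to $M$. Its set of vertices is $M$. *)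

(* Defs.v *)
From mathcomp Require Import all_boot finmap.
From mathcomp Require Import boolp classical_sets functions cardinality fsbigop.

Set Implicit Arguments.
Unset Strict Implicit.
Unset Printing Implicit Defensive.

Local Open Scope classical_set_scope.

(* A simplex is given by its vertex set; {classic B} only provides the choice
   structure that fset_set needs. *)
Definition simplex_dim (B : Type) (S : set B) : nat :=
  #|` fset_set (S : set {classic B})|.-1.

(* Cells of the weak direct product C(A, B). *)
Record cell (A B : Type) := Cell {
  factor :> A -> set B;
  factor_finite : forall x, finite_set (factor x);
  factor_nonempty : forall x, factor x !=set0;
  factor_weak : finite_set [set x | 1 <= simplex_dim (factor x)]
}.

(* The sum has finite support by factor_weak. *)
Definition dim (A B : Type) (s : cell A B) : nat :=
  \big[addn/0]_(x \in [set: {classic A}]) simplex_dim (s x).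

Definition face (A B : Type) (t s : cell A B) : Prop :=
  forall x, t x `<=` s x.

(* All complexes below are sets of cells of some C(A, B). *)
Definition faces (A B : Type) (s : cell A B) : set (cell A B) :=
  [set t | face t s].

Definition skeleton (n : nat) (A B : Type) (X : set (cell A B)) :
    set (cell A B) :=
  [set s | X s /\ dim s <= n].

Definition hom_complex (A B : Type) (M : set (A -> B)) : set (cell A B) :=
  [set s | forall phi : A -> B, (forall x, s x (phi x)) -> M phi].

(* X and Y are coerced to the types of their cells, so that an isomorphism is
   a bijection between the cells of X and those of Y, independent of the
   ambient C(A, B) and C(A', B'). *)
Definition isomorphic (A B A' B' : Type)
    (X : set (cell A B)) (Y : set (cell A' B')) : Prop :=
  exists f : X -> Y,
    [/\ bijective f,
        forall s t : X, face (val t) (val s) <-> face (val (f t)) (val (f s))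
      & forall s : X, dim (val (f s)) = dim (val s)].

(* X is a subcomplex of Y that contains every cell of Y whose vertices all
   lie in X. *)
Definition full_subcomplex (A B : Type) (X Y : set (cell A B)) : Prop :=
  [/\ X `<=` Y,
      forall s, X s -> faces s `<=` X
    & forall s, Y s -> skeleton 0 (faces s) `<=` X -> X s].

(* Main.v *)
(* The 1-skeleton of Hom_M(A,B) is the graph on M in which two maps are adjacent
   when they differ at exactly one point. In such a graph the vertices of a
   triangle differ at one and the same point, and two vertices at distance two
   have exactly two common neighbours. Hence an adjacency-preserving injection
   of the vertices of a product of simplices p sends parallel edges to parallel
   edges, and the image is again the vertex set of a product of simplices of
   the same dimension. Cells and the face relation are determined by vertex
   sets, so a graph isomorphism extends to an isomorphism of complexes. Since
   the faces of p form Hom_N for N the set of vertices of p, and every full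
   subcomplex of the 1-skeleton of Hom_M is the 1-skeleton of some Hom_N, the
   case of an abstract p reduces to the same statement. *)
Require Import Defs.
From mathcomp Require Import all_boot finmap.
From mathcomp Require Import boolp classical_sets functions cardinality fsbigop.

Set Implicit Arguments.
Unset Strict Implicit.

Local Open Scope classical_set_scope.

(** * Vertices of cells, adjacency and one-point changes of maps *)

Definition vertices {A B : Type} (s : cell A B) : set (A -> B) :=
  [set phi | forall x, s x (phi x)].

Definition adjacent_at {A B : Type} (a : A) (u v : A -> B) : Prop :=
  u a <> v a /\ forall x, x <> a -> u x = v x.

Definition adjacent {A B : Type} (u v : A -> B) : Prop :=
  exists a, adjacent_at a u v.

Definition update {A B : Type} (v : A -> B) (a : A) (b : B) : A -> B :=
  fun x => if pselect (x = a) then b else v x.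

Lemma update_at {A B : Type} (v : A -> B) a b : update v a b a = b.
Proof. by rewrite /update; case: pselect. Qed.

Lemma update_neq {A B : Type} (v : A -> B) a b x :
  x <> a -> update v a b x = v x.
Proof. by rewrite /update; case: pselect. Qed.

Lemma update_id {A B : Type} (v : A -> B) a : update v a (v a) = v.
Proof. by apply/funext => x; rewrite /update; case: pselect => //= ->. Qed.

Lemma update_update {A B : Type} (v : A -> B) a b b' :
  update (update v a b) a b' = update v a b'.
Proof. by apply/funext => x; rewrite /update; case: pselect. Qed.

Lemma updateC {A B : Type} (v : A -> B) a a' b b' : a <> a' ->
  update (update v a b) a' b' = update (update v a' b') a b.
Proof.
move=> aa'; apply/funext => x; rewrite /update.
by do 2![case: pselect] => //= xa xa'; case: aa'; rewrite -xa -xa'.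
Qed.

Lemma eq_update {A B : Type} (u v : A -> B) a b :
  v a = b -> (forall x, x <> a -> v x = u x) -> v = update u a b.
Proof.
move=> va vu; apply/funext => x; rewrite /update.
by case: pselect => /= [->|/vu].
Qed.

Lemma update_adjacent_at {A B : Type} (u : A -> B) a b :
  u a <> b -> adjacent_at a u (update u a b).
Proof. by move=> ub; split=> [|x xa]; rewrite ?update_at ?update_neq. Qed.

Lemma adjacent_at_sym {A B : Type} (a : A) (u v : A -> B) :
  adjacent_at a u v -> adjacent_at a v u.
Proof. by case=> uv e; split=> [/esym//|x /e]. Qed.

Lemma adjacent_sym {A B : Type} (u v : A -> B) :
  adjacent u v -> adjacent v u.
Proof. by move=> [a uv]; exists a; apply: adjacent_at_sym. Qed.

Lemma update_vertices {A B : Type} (s : cell A B) v a b :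
  vertices s v -> s a b -> vertices s (update v a b).
Proof. by move=> sv sb x; rewrite /update; case: pselect => //= ->. Qed.

Lemma vertices_nonempty {A B : Type} (s : cell A B) : vertices s !=set0.
Proof.
have [phi h] := choice (factor_nonempty s); by exists phi.
Qed.

(** Every point of [t x] is the value at [x] of some vertex of [t]: change any vertex of [t] at
    [x]. *)
Lemma face_vertices {A B : Type} (t s : cell A B) :
  face t s <-> vertices t `<=` vertices s.
Proof.
split=> [ts u tu x|ts x b tb]; first exact/ts/tu.
have [v tv] := vertices_nonempty t.
have /ts /(_ x) := update_vertices tv tb.
by rewrite update_at.
Qed.

Lemma eq_cell {A B : Type} (s t : cell A B) : vertices s = vertices t -> s = t.
Proof.
move=> e; have st : face s t by apply/face_vertices; rewrite e.
have ts : face t s by apply/face_vertices; rewrite e.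
have : factor s = factor t by apply/funext => x; apply/seteqP.
case: s t {e st ts} => s s1 s2 s3 [t t1 t2 t3] /= e.
move: s1 s2 s3 t1 t2 t3; rewrite e => *; congr Cell; exact: Prop_irrelevance.
Qed.

(** * Dimension of simplices and cells; cells of dimension 0 and 1 *)

Lemma simplex_dim_gt0 {B : Type} (S : set B) : finite_set S ->
  1 <= simplex_dim S <-> exists b b', [/\ S b, S b' & b <> b'].
Proof.
move=> fS; have memS b : (b \in fset_set (S : set {classic B})) <-> S b.
  by rewrite in_fset_set// inE.
split=> [d1|[b [b' [/memS Sb /memS Sb' bb']]]].
  have /fset0Pn[b Sb] : fset_set (S : set {classic B}) != fset0.
    by rewrite -cardfs_gt0; move: d1; rewrite /simplex_dim; case: #|` _|.
  have : 0 < #|` fset_set (S : set {classic B}) `\ b|%fset.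
    by move: d1; rewrite /simplex_dim (cardfsD1 b) Sb.
  rewrite cardfs_gt0 => /fset0Pn[b']; rewrite in_fsetD1 => /andP[/eqP b'b Sb'].
  by exists b, b'; split; [exact/memS|exact/memS|move=> /esym].
rewrite /simplex_dim (cardfsD1 (b : {classic B})) Sb /= cardfs_gt0.
apply/fset0Pn; exists b'; rewrite in_fsetD1 Sb' andbT.
by apply/eqP => /esym.
Qed.

Lemma simplex_dim_eq0 {B : Type} (S : set B) b b' : finite_set S ->
  simplex_dim S = 0 -> S b -> S b' -> b = b'.
Proof.
move=> fS d0 Sb Sb'; apply: contrapT => bb'.
have : 1 <= simplex_dim S by apply/(simplex_dim_gt0 fS); exists b, b'.
by rewrite d0.
Qed.

(** Makes [dim] an ordinary finite sum, from which single terms can be split off. *)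
Lemma dim_support {A B : Type} (s : cell A B) (D : set A) :
  finite_set D -> [set x | 1 <= simplex_dim (s x)] `<=` D ->
  dim s = \sum_(x <- fset_set (D : set {classic A})) simplex_dim (s x).
Proof.
move=> fD sD; rewrite -fsbig_finite// /dim; symmetry.
apply: fsbig_widen => // x [_ Dx] /=.
by apply/eqP; rewrite -leqn0 leqNgt; apply/negP => /sD.
Qed.

Lemma dim_le1 {A B : Type} (s : cell A B) a b : dim s <= 1 ->
  1 <= simplex_dim (s a) -> 1 <= simplex_dim (s b) -> a = b.
Proof.
move=> d1 da db; apply: contrapT => ab.
have fw := factor_weak s; move: d1; rewrite (dim_support fw)//.
rewrite (big_fsetD1 (a : {classic A})) ?in_fset_set ?inE//=.
rewrite (big_fsetD1 (b : {classic A})) /=; last first.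
  rewrite in_fsetD1 in_fset_set//; apply/andP; split; last by rewrite inE.
  by apply/eqP => /esym.
by move=> d1; have := leq_trans (leq_add da (leq_trans db (leq_addr _ _))) d1.
Qed.

Lemma dim_eq0 {A B : Type} (s : cell A B) : dim s = 0 ->
  exists phi, vertices s = [set phi].
Proof.
move=> d0; have [phi sphi] := vertices_nonempty s; exists phi.
apply/seteqP; split=> [psi spsi|_ -> //].
apply/funext => x; apply: simplex_dim_eq0 (spsi x) (sphi x).
  exact: factor_finite.
apply/eqP; rewrite -leqn0 leqNgt; apply/negP => dx.
have fw := factor_weak s; move: d0; rewrite (dim_support fw)//.
rewrite (big_fsetD1 (x : {classic A})) ?in_fset_set ?inE//=.
by case: simplex_dim dx.
Qed.

(** Each point where [u] and [v] differ gives a factor of positive dimension, and [s] has at most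
    one such factor. *)
Lemma edge_adjacent {A B : Type} (s : cell A B) u v : dim s <= 1 ->
  vertices s u -> vertices s v -> u <> v -> adjacent u v.
Proof.
move=> d1 su sv uv.
have [a uva] : exists a, u a <> v a.
  apply: contrapT => h; apply: uv; apply/funext => x.
  by apply: contrapT => uvx; apply: h; exists x.
have dgt x : u x <> v x -> 1 <= simplex_dim (s x).
  move=> ?; apply/simplex_dim_gt0; first exact: factor_finite.
  by exists (u x), (v x).
exists a; split=> // x xa; apply: contrapT => /dgt dx; apply: xa.
exact: dim_le1 d1 dx (dgt _ uva).
Qed.

Lemma simplex_dim1 {B : Type} (b : B) : simplex_dim [set b] = 0.
Proof. by rewrite /simplex_dim (fset_set1 (b : {classic B})) cardfs1. Qed.

Lemma exists_vertex_cell {A B : Type} (u : A -> B) :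
  exists s : cell A B, vertices s = [set u] /\ dim s = 0.
Proof.
have fw : finite_set [set x : A | 1 <= simplex_dim [set u x]].
  rewrite (_ : mkset _ = set0)//; apply/seteqP; split=> x //=.
  by rewrite simplex_dim1.
exists (@Cell A B (fun x => [set u x]) (fun x => finite_set1 _)
  (fun x => ex_intro _ (u x) erefl) fw); split.
  apply/seteqP; split=> [v h|_ ->]; last by [].
  by apply/funext => x; exact: h.
by rewrite /dim fsbig1// => x _; rewrite /= simplex_dim1.
Qed.

Lemma exists_edge_cell {A B : Type} (u v : A -> B) : adjacent u v ->
  exists s : cell A B, vertices s = [set u; v] /\ dim s = 1.
Proof.
case=> a [uva uv].
pose S x := [set u x; v x].
have S0 x : x <> a -> simplex_dim (S x) = 0.
  by move=> /uv e; rewrite /S e setUid simplex_dim1.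
have S1 : simplex_dim (S a) = 1.
  rewrite /simplex_dim /S (@fset_setU {classic B})//.
  rewrite !(@fset_set1 {classic B}) cardfs2.
  by case: eqP.
have fw : finite_set [set x : A | 1 <= simplex_dim (S x)].
  apply: (@sub_finite_set _ _ [set a]) => // x /=.
  by move=> d; apply: contrapT => /S0 e; rewrite e in d.
exists (@Cell A B S (fun x => finite_set2 _ _)
  (fun x => ex_intro _ (u x) (or_introl erefl)) fw); split.
  apply/seteqP; split=> [w h|_ [->|->]]; [|by left|by right].
  have e x : x <> a -> w x = u x.
    by move=> xa; have [//|->] := h x; rewrite uv.
  have [wu|wv] := h a; [left|right]; apply/funext => x.
    by have [->//|/e] := pselect (x = a).
  by have [->//|xa] := pselect (x = a); rewrite e// uv.
have fa : finite_set [set a] by [].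
rewrite (dim_support fa) /=; last first.
  by move=> x /= d; apply: contrapT => /S0 e; rewrite e in d.
by rewrite (@fset_set1 {classic A}) big_seq_fset1.
Qed.

(** * Triangles and squares in the graph of maps *)

(** If [a] and [a'] were different, [v] and [w] would differ at both points. *)
Lemma adjacent_triangle {A B : Type} (u v w : A -> B) a a' :
  adjacent_at a u v -> adjacent_at a' u w -> adjacent v w -> a = a'.
Proof.
case=> uva uv [uwa' uw] [e [_ vw]]; apply: contrapT => aa'.
have ea : a = e by apply: contrapT => /vw; rewrite -uw// => /esym.
have ea' : a' = e.
  by apply: contrapT => /vw; rewrite -uv// => h; apply: aa'.
by rewrite ea ea' in aa'.
Qed.

Lemma adjacent_at_trans {A B : Type} (u v w : A -> B) a :
  adjacent_at a u v -> adjacent_at a u w -> v = w \/ adjacent_at a v w.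
Proof.
case=> _ uv [_ uw]; have [e|ne] := pselect (v a = w a); [left|right].
  apply/funext => x; have [->//|xa] := pselect (x = a).
  by rewrite -uv// uw.
by split=> // x xa; rewrite -uv// uw.
Qed.

(** Two vertices at distance two have only two common neighbours; here these are [u] and the
    opposite corner of the square. *)
Lemma adjacent_square {A B : Type} (u v : A -> B) a a' b b' :
  a <> a' -> u a <> b -> u a' <> b' -> v <> u ->
  adjacent v (update u a b) -> adjacent v (update u a' b') ->
  v = update (update u a' b') a b.
Proof.
move=> aa' ub ub' vu [e [_ ve]] [e' [_ ve']].
(* If [v] leaves [update u a b] in direction [a], it is forced back to [u]; otherwise it leaves
   [update u a' b'] in direction [a], which gives the opposite corner. *)
have [ea|ea] := pselect (e = a).
  have e'a' : e' = a'.
    apply: contrapT => e'a'; have := ve' a' (fun h => e'a' (esym h)).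
    by rewrite update_at ve ?update_neq ?ea//; exact: nesym.
  subst e e'; case: vu; apply/funext => x; have [->|xa] := pselect (x = a).
    by rewrite ve'// update_neq.
  by rewrite ve// update_neq.
have e'a : e' = a.
  apply: contrapT => e'a; have := ve a (fun h => ea (esym h)).
  rewrite update_at ve' ?update_neq; [|exact: aa'|exact: nesym].
  by move=> h; apply: ub.
apply: eq_update => [|x xa]; first by rewrite ve ?update_at//; exact: nesym.
by rewrite ve'// e'a.
Qed.

(** * Images of products of simplices under adjacency-preserving injections *)

Lemma simplex_dim_image {B B' : Type} (S : set B) (g : B -> B') :
  finite_set S -> (forall b b', S b -> S b' -> g b = g b' -> b = b') ->
  simplex_dim (g @` S) = simplex_dim S.
Proof.
move=> fS ginj; rewrite /simplex_dim.
rewrite (@fset_set_image {classic B} {classic B'} g S fS).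
rewrite card_in_imfset//= => b b'.
rewrite !in_fset_set// => /set_mem Sb /set_mem Sb'.
exact: ginj.
Qed.

(* Seen from a base vertex v0, the edges of p in direction x are pairwise
   adjacent, so F sends them all to one direction c x. The images of the other
   vertices are then forced, since F preserves the squares of p. *)
Lemma adjacent_coordinates {A B A' B' : Type} (a0 : A') (p : cell A B)
    (F : (A -> B) -> (A' -> B')) (v0 : A -> B) :
  (forall u v, vertices p u -> vertices p v -> F u = F v -> u = v) ->
  (forall u v, vertices p u -> vertices p v ->
     adjacent u v <-> adjacent (F u) (F v)) ->
  vertices p v0 ->
  exists (c : A -> A') (g : A -> B -> B'), let D x := 1 <= simplex_dim (p x) in
  [/\ forall x y, D x -> D y -> c x = c y -> x = y,
      forall x b b', D x -> p x b -> p x b' -> g x b = g x b' -> b = b',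
      forall v x, vertices p v -> D x -> F v (c x) = g x (v x)
    & forall v a, vertices p v -> (forall x, D x -> c x <> a) ->
        F v a = F v0 a].
Proof.
move=> Finj Fadj pv0.
have Vp v x b : vertices p v -> p x b -> vertices p (update v x b).
  exact: update_vertices.
have upd_inj (v : A -> B) x b b' : update v x b = update v x b' -> b = b'.
  by move=> /(congr1 (fun f => f x)); rewrite !update_at.
have ctotal x : exists a, forall b, p x b -> v0 x <> b ->
    adjacent_at a (F v0) (F (update v0 x b)).
  have [[b0 [pb0 v0b0]]|nb] := pselect (exists b, p x b /\ v0 x <> b); last first.
    (* If [p x] is a single point, the condition is void and [a0] is a default value. *)
    by exists a0 => b pb v0b; case: nb; exists b.
  have /Fadj [//||a ha] : adjacent v0 (update v0 x b0).
    by exists x; exact: update_adjacent_at.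
    exact: Vp.
  exists a => b pb v0b.
  have /Fadj [//||a' ha'] : adjacent v0 (update v0 x b).
    by exists x; exact: update_adjacent_at.
    exact: Vp.
  (* Two edges at [v0] in direction [x] span a triangle, whose image is again a triangle and so has
     a single direction. *)
  have [/upd_inj <-//|bb0] := adjacent_at_trans (update_adjacent_at v0b0)
    (update_adjacent_at v0b).
  have : adjacent (update v0 x b0) (update v0 x b) by exists x.
  by move=> /Fadj/(adjacent_triangle ha ha') ->//; exact: Vp.
have [c hc] := choice ctotal.
pose g x b := F (update v0 x b) (c x).
have Dex x : 1 <= simplex_dim (p x) -> exists b, p x b /\ v0 x <> b.
  move=> /simplex_dim_gt0[|b [b' [pb pb' bb']]]; first exact: factor_finite.
  have [e|] := pselect (v0 x = b); last by exists b.
  by exists b'; split=> //; rewrite e.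
have notD x b : p x b -> v0 x <> b -> 1 <= simplex_dim (p x).
  move=> pb v0b; apply/simplex_dim_gt0; first exact: factor_finite.
  by exists (v0 x), b; split=> //; exact: pv0.
have F0 x b : p x b -> F (update v0 x b) = update (F v0) (c x) (g x b).
  move=> pb; have [<-|v0b] := pselect (v0 x = b).
    by rewrite /g update_id update_id.
  apply: eq_update => // y yc; have [_ e] := hc _ _ pb v0b.
  by rewrite e.
have cinj x y : 1 <= simplex_dim (p x) -> 1 <= simplex_dim (p y) ->
    c x = c y -> x = y.
  move=> /Dex[b [pb v0b]] /Dex[b' [pb' v0b']] cxy; apply: contrapT => xy.
  have hx := hc _ _ pb v0b; have hy := hc _ _ pb' v0b'; rewrite cxy in hx.
  have yx : y <> x by exact: nesym.
  (* If [c x = c y], the images of the two neighbours of [v0] are equal or adjacent. Then so are the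
     neighbours, which is impossible in different directions. *)
  have [/Finj e|h] := adjacent_at_trans hx hy.
    have /(congr1 (fun f => f x)) := e (Vp _ _ _ pv0 pb) (Vp _ _ _ pv0 pb').
    by rewrite update_at update_neq// => /esym.
  have /Fadj h' : adjacent (F (update v0 x b)) (F (update v0 y b')).
    by exists (c y).
  apply: xy; apply: (@adjacent_triangle _ _ v0 (update v0 x b) (update v0 y b')).
  - exact: update_adjacent_at.
  - exact: update_adjacent_at.
  - by apply: h'; exact: Vp.
have ginj x b b' : 1 <= simplex_dim (p x) -> p x b -> p x b' ->
    g x b = g x b' -> b = b'.
  move=> Dx pb pb' e; apply: (upd_inj v0 x); apply: Finj; try exact: Vp.
  by rewrite !F0// e.
(* Induction on a finite list containing all points where [v] differs from [v0]. The first claim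
   extends [F0] from [v0] to [v]: [F] turns every change of [v] into a change at [c x] with the same
   new value [g x b]. *)
have main (E : seq {classic A}) : forall v, vertices p v ->
    (forall x : {classic A}, v x <> v0 x -> x \in E) ->
    (forall x b, 1 <= simplex_dim (p x) -> p x b ->
       F (update v x b) = update (F v) (c x) (g x b)) /\
    (forall a, (forall x, 1 <= simplex_dim (p x) -> c x <> a) ->
       F v a = F v0 a).
  elim: E => [v pv vE|y E IH v pv vE].
    have -> : v = v0 by apply/funext => x; apply: contrapT => /vE.
    by split=> // x b _; exact: F0.
  have [vy|vy] := pselect (v y = v0 y).
    apply: IH => // x vx; have := vE _ vx; rewrite in_cons => /orP[/eqP xy|//].
    by rewrite xy vy in vx.
  (* Resetting [v] at [y] gives a vertex [u] covered by the induction hypothesis, of which [v] is a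
     neighbour in direction [y]. *)
  pose u := update v y (v0 y).
  have pu : vertices p u by apply: Vp => //; exact: pv0.
  have vu : v = update u y (v y) by rewrite /u update_update update_id.
  have Dy : 1 <= simplex_dim (p y) by apply: notD (pv y) _; exact: nesym.
  have [|Q P] := IH u pu.
    move=> x; have [->|xy] := pselect (x = y); first by rewrite /u update_at.
    rewrite /u update_neq// => /vE; rewrite in_cons => /orP[/eqP//|//].
  have Fv : F v = update (F u) (c y) (g y (v y)) by rewrite {1}vu Q.
  split=> [x b Dx pb|a ac]; last first.
    by rewrite Fv update_neq; [exact: P|exact/nesym/ac].
  have [xy|xy] := pselect (x = y).
    have -> : update v x b = update u x b by rewrite vu xy update_update.
    by rewrite Fv Q// xy update_update.
  have cxy : c x <> c y by move=> /cinj; exact: (fun h => xy (h Dx Dy)).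
  have [uxb|uxb] := pselect (u x = b).
    have <- : v x = b by rewrite vu update_neq.
    rewrite update_id; apply: eq_update => //.
    rewrite Fv update_neq//; have := Q x b Dx pb; rewrite -{1}uxb update_id => ->.
    by rewrite update_at; congr g; rewrite -uxb vu update_neq.
  have pvb : vertices p (update v x b) by exact: Vp.
  have pub : vertices p (update u x b) by exact: Vp.
  have vb : update v x b = update (update u x b) y (v y).
    by rewrite {1}vu updateC//; exact: nesym.
  have ub : F u (c x) <> g x b.
    move=> e; have := Q x b Dx pb; rewrite -e update_id => /(Finj _ _ pub pu) h.
    by apply: uxb; rewrite -h update_at.
  have uv : F u (c y) <> g y (v y).
    move=> e; have := Fv; rewrite -e update_id => /(Finj _ _ pv pu) h.
    by apply: vy; rewrite h /u update_at.
  (* In the square [u], [v], [update u x b], [update v x b] the first three images are known. The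
     fourth is adjacent to two of them and, by injectivity, is not [F u], so it is the opposite
     corner. *)
  rewrite Fv; apply: adjacent_square => //.
  - move=> /(Finj _ _ pvb pu) h; apply: uxb; rewrite -h update_at//.
  - rewrite -Q//; apply/Fadj => //; rewrite vb; apply: adjacent_sym.
    exists y; apply: update_adjacent_at; rewrite update_neq; last exact: nesym.
    by rewrite /u update_at; exact: nesym.
  - rewrite -Fv; apply/Fadj => //; apply: adjacent_sym.
    by exists x; apply: update_adjacent_at; rewrite vu update_neq.
exists c, g; split=> // [v x pv Dx|v a pv ac].
  (* Vertices of [p] differ only at factors of positive dimension, so a list of these serves for
     every [v]. *)
  have [E EP] := (@finite_seqP {classic A} _).1 (factor_weak p).
  have [|Q _] := main E v pv.
    move=> y vy; suff : [set x | 1 <= simplex_dim (p x)] y by rewrite EP.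
    by apply: notD (pv y) _; exact: nesym.
  by have /(congr1 (fun f => f (c x))) := Q x (v x) Dx (pv x);
    rewrite update_id update_at.
have [E EP] := (@finite_seqP {classic A} _).1 (factor_weak p).
have [|_] := main E v pv; last exact.
move=> y vy; suff : [set x | 1 <= simplex_dim (p x)] y by rewrite EP.
by apply: notD (pv y) _; exact: nesym.
Qed.

Lemma image_cell {A B A' B' : Type} (p : cell A B)
    (F : (A -> B) -> (A' -> B')) :
  (forall u v, vertices p u -> vertices p v -> F u = F v -> u = v) ->
  (forall u v, vertices p u -> vertices p v ->
     adjacent u v <-> adjacent (F u) (F v)) ->
  exists s : cell A' B', vertices s = F @` vertices p /\ dim s = dim p.
Proof.
move=> Finj Fadj; have [v0 pv0] := vertices_nonempty p.
(* If [A'] is empty there is only one map to [B'], so by injectivity [p] is a single vertex. *)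
have [[a0 _]|noA'] := pselect (exists a : A', True); last first.
  have Vp v : vertices p v -> v = v0.
    move=> pv; apply: Finj => //; apply/funext => a.
    by case: noA'; exists a.
  have [s [sV s0]] := exists_vertex_cell (F v0); exists s.
  have -> : dim p = 0.
    have [q [qV q0]] := exists_vertex_cell v0; rewrite -q0; congr dim.
    by apply: eq_cell; rewrite qV; apply/seteqP; split=> [v /Vp|_ ->].
  split=> //; rewrite sV; apply/seteqP; split=> [_ ->|_ [v /Vp -> <-]//].
  by exists v0.
have [c [g /= [cinj ginj Fc Fout]]] :=
  adjacent_coordinates a0 Finj Fadj pv0.
set D := [set x | 1 <= simplex_dim (p x)].
have fD : finite_set D := factor_weak p.
pose S a := [set F v a | v in vertices p].
have Sc x : D x -> S (c x) = g x @` p x.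
  move=> Dx; apply/seteqP; split=> [_ [v pv <-]|_ [b pb <-]].
    by exists (v x); [exact: pv|rewrite Fc].
  exists (update v0 x b); first exact: update_vertices.
  by rewrite Fc//; [rewrite update_at|exact: update_vertices].
have Sout a : (forall x, D x -> c x <> a) -> S a = [set F v0 a].
  move=> ac; apply/seteqP; split=> [_ [v pv <-]|_ ->]; last by exists v0.
  exact: Fout.
have Scases a : (exists2 x, D x & c x = a) \/ (forall x, D x -> c x <> a).
  by have [h|/forall2NP h] := pselect (exists2 x, D x & c x = a);
    [left|right => x Dx; case: (h x)].
have Sfin a : finite_set (S a).
  have [[x Dx <-]|/Sout ->] := Scases a; last exact: finite_set1.
  by rewrite Sc//; apply: finite_image; exact: factor_finite.
have Sne a : S a !=set0 by exists (F v0 a); exists v0.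
have Sdim x : D x -> simplex_dim (S (c x)) = simplex_dim (p x).
  move=> Dx; rewrite Sc//; apply: simplex_dim_image; first exact: factor_finite.
  by move=> b b'; exact: ginj.
have SD : [set a | 1 <= simplex_dim (S a)] `<=` c @` D.
  move=> a /= da; have [[x Dx <-]|/Sout e] := Scases a; first by exists x.
  by rewrite e simplex_dim1 in da.
have fcD : finite_set (c @` D) by exact: finite_image.
exists (Cell Sfin Sne (sub_finite_set SD fcD)); split.
  apply/seteqP; split=> [phi sphi|_ [v pv <-]]; last by move=> a; exists v.
  (* A preimage of [phi] is chosen coordinate by coordinate; outside [D] the value of [v0] is
     taken. *)
  have hb x : exists b, p x b /\ (D x -> phi (c x) = g x b).
    have [Dx|nD] := pselect (D x); last by exists (v0 x); split=> //; exact: pv0.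
    by have := sphi (c x); rewrite /= Sc// => -[b pb <-]; exists b.
  have [v hv] := choice hb; have pv : vertices p v by move=> x; case: (hv x).
  exists v => //; apply/funext => a.
  have [[x Dx <-]|ac] := Scases a; first by rewrite Fc//; case: (hv x) => _ ->.
  by have := sphi a; rewrite /= Sout// => ->; exact: Fout.
rewrite (dim_support fD)// (dim_support fcD)//=.
rewrite -(@fsbig_finite _ _ _ {classic A'} _ _ fcD).
rewrite -(@fsbig_finite _ _ _ {classic A} _ _ fD).
(* The sum is reindexed along [c], which is injective on [D]. *)
rewrite (@fsbig_image _ _ _ {classic A} {classic A'}); last first.
  by move=> x y /set_mem Dx /set_mem Dy; exact: cinj.
by apply: eq_fsbigr => x /set_mem /Sdim.
Qed.

(** * From isomorphisms of 1-skeletons to graph isomorphisms *)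

(* Vertices of the complex are maps here, not cells of dimension 0. *)
Definition graph_isomorphic {A B A' B' : Type} (M : set (A -> B))
    (M' : set (A' -> B')) : Prop :=
  exists F : M -> M', bijective F /\
    forall u v : M, adjacent (val u) (val v) <-> adjacent (val (F u)) (val (F v)).

Lemma hom_complex_vertices {A B : Type} (M : set (A -> B)) (s : cell A B) :
  hom_complex M s <-> vertices s `<=` M.
Proof. by []. Qed.

Lemma faces_hom_complex {A B : Type} (s : cell A B) :
  faces s = hom_complex (vertices s).
Proof. by apply/funext => t; apply/propext; exact: face_vertices. Qed.

Lemma skeleton_vertex {A B : Type} (M : set (A -> B)) (u : M) :
  exists s : skeleton 1 (hom_complex M),
    vertices (val s) = [set val u] /\ dim (val s) = 0.
Proof.
have [s [sV s0]] := exists_vertex_cell (val u).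
have Xs : s \in skeleton 1 (hom_complex M).
  rewrite inE; split; last by rewrite s0.
  by apply/hom_complex_vertices; rewrite sV => _ ->; exact: set_valP.
by exists (exist _ s Xs).
Qed.

(** Preserving dimension, [f] sends cells of dimension 0 to cells of dimension 0, and these have
    exactly one vertex. *)
Lemma skeleton_vertex_map {A B A' B' : Type} (M : set (A -> B))
    (M' : set (A' -> B'))
    (f : skeleton 1 (hom_complex M) -> skeleton 1 (hom_complex M')) :
  (forall s, dim (val (f s)) = dim (val s)) ->
  exists F : M -> M', forall (u : M) s, vertices (val s) = [set val u] ->
    vertices (val (f s)) = [set val (F u)].
Proof.
move=> fdim.
suff /choice[F FP] : forall u : M, exists w : M', forall s,
  vertices (val s) = [set val u] -> vertices (val (f s)) = [set val w].
  by exists F.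
move=> u.
have [s [sV s0]] := skeleton_vertex u.
have [w wV] : exists w, vertices (val (f s)) = [set w].
  by apply: dim_eq0; rewrite fdim.
have Mw : w \in M'.
  have [h _] := set_valP (f s).
  by rewrite inE; apply: (iffLR (hom_complex_vertices _ _) h); rewrite wV.
exists (exist _ w Mw) => t tV; rewrite -wV; congr (vertices (val (f _))).
by apply: val_inj; apply: eq_cell; rewrite tV sV.
Qed.

(** The edge cell on [u] and [v] goes to a cell of dimension at most 1 containing both image
    vertices, which are distinct by injectivity. Only one direction for faces is assumed, so that
    the lemma serves [f] and its inverse alike. *)
Lemma skeleton_map_adjacent {A B A' B' : Type} (M : set (A -> B))
    (M' : set (A' -> B'))
    (f : skeleton 1 (hom_complex M) -> skeleton 1 (hom_complex M'))
    (F : M -> M') :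
  (forall s t, face (val t) (val s) -> face (val (f t)) (val (f s))) ->
  injective F ->
  (forall (u : M) s, vertices (val s) = [set val u] ->
     vertices (val (f s)) = [set val (F u)]) ->
  forall u v : M, adjacent (val u) (val v) -> adjacent (val (F u)) (val (F v)).
Proof.
move=> fface Finj fF u v uv.
have [e [eV e1]] := exists_edge_cell uv.
have Xe : e \in skeleton 1 (hom_complex M).
  rewrite inE; split; last by rewrite e1.
  by apply/hom_complex_vertices; rewrite eV => _ [->|->]; exact: set_valP.
pose e' := f (exist _ e Xe).
have Fe w : vertices e (val w) -> vertices (val e') (val (F w)).
  move=> ew; have [s [sV _]] := skeleton_vertex w.
  have : face (val s) e by apply/face_vertices; rewrite sV => _ ->.
  move=> /(fface (exist _ e Xe) s)/face_vertices; apply.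
  by rewrite (fF w).
apply: (@edge_adjacent _ _ (val e')).
- by have [] := set_valP e'.
- by apply: Fe; rewrite eV; left.
- by apply: Fe; rewrite eV; right.
- move=> /val_inj/Finj e0; have [a [ne _]] := uv.
  by rewrite e0 in ne.
Qed.

Lemma skeleton_isomorphic_graph {A B A' B' : Type} (M : set (A -> B))
    (M' : set (A' -> B')) :
  isomorphic (skeleton 1 (hom_complex M)) (skeleton 1 (hom_complex M')) ->
  graph_isomorphic M M'.
Proof.
case=> f [[g fK gK] fface fdim].
have gdim s : dim (val (g s)) = dim (val s) by rewrite -fdim gK.
have gface s t : face (val t) (val s) -> face (val (g t)) (val (g s)).
  by rewrite fface !gK.
have [F fF] := skeleton_vertex_map fdim.
have [G gG] := skeleton_vertex_map gdim.
have set1_val (T : Type) (N : set T) (u v : N) : [set val u] = [set val v] -> u = v.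
  by move=> e; apply: val_inj; have : [set val u] (val u) by []; rewrite e.
have FK : cancel F G.
  move=> u; apply: set1_val; have [s [sV _]] := skeleton_vertex u.
  by rewrite -(gG (F u) (f s)) ?fK// (fF u).
have GK : cancel G F.
  move=> u; apply: set1_val; have [s [sV _]] := skeleton_vertex u.
  by rewrite -(fF (G u) (g s)) ?gK// (gG u).
exists F; split; first by exists G.
move=> u v; split.
  apply: (skeleton_map_adjacent _ (can_inj FK) fF).
  by move=> s t; rewrite fface.
by move=> /(skeleton_map_adjacent gface (can_inj GK) gG); rewrite !FK.
Qed.

(** * From graph isomorphisms to isomorphisms of complexes *)

Lemma graph_isomorphic_cell {A B A' B' : Type} (M : set (A -> B))
    (M' : set (A' -> B')) (F : M -> M') (p : cell A B) :
  injective F ->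
  (forall u v : M,
     adjacent (val u) (val v) <-> adjacent (val (F u)) (val (F v))) ->
  hom_complex M p ->
  exists s : cell A' B', [/\ hom_complex M' s, dim s = dim p &
    forall u : M, vertices s (val (F u)) <-> vertices p (val u)].
Proof.
move=> Finj Fadj /hom_complex_vertices pM.
have [v0 pv0] := vertices_nonempty p.
have Mp v : vertices p v -> v \in M by move=> /pM; rewrite inE.
pose w0 := val (F (exist _ v0 (Mp v0 pv0))).
(* [image_cell] takes a map on all of [A -> B]; outside [M] the value [w0] is a default. *)
pose F' v := if pselect (v \in M) is left h then val (F (exist _ v h)) else w0.
have F'E (u : M) : F' (val u) = val (F u).
  rewrite /F'; case: pselect => [h|]; last by case: (valP u).
  by congr (val (F _)); exact: val_inj.
have lift v : vertices p v -> exists u : M, val u = v.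
  by move=> /Mp h; exists (exist _ v h).
have [||s [sV sdim]] := @image_cell _ _ _ _ p F'.
- by move=> _ _ /lift[u <-] /lift[v <-]; rewrite !F'E => /val_inj/Finj ->.
- by move=> _ _ /lift[u <-] /lift[v <-]; rewrite !F'E.
exists s; split=> //.
  apply/hom_complex_vertices; rewrite sV => _ [_ /lift[u <-] <-].
  by rewrite F'E; exact: set_valP.
move=> u; rewrite sV; split=> [[v pv]|pu].
  have [w e] := lift v pv.
  by rewrite -e F'E => /val_inj/Finj wu; rewrite -wu e.
by exists (val u).
Qed.

(** Each cell goes to the cell on the image of its vertex set. Faces and equality of cells are read
    off vertex sets, so the cell maps from [F] and its inverse are mutually inverse and respect
    faces. *)
Lemma graph_isomorphic_complex {A B A' B' : Type} (M : set (A -> B))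
    (M' : set (A' -> B')) :
  graph_isomorphic M M' -> isomorphic (hom_complex M) (hom_complex M').
Proof.
case=> F [[G FK GK] Fadj].
have Gadj (u v : M') :
    adjacent (val u) (val v) <-> adjacent (val (G u)) (val (G v)).
  by rewrite Fadj !GK.
have cell_map (C D C1 D1 : Type) (N : set (C -> D)) (N' : set (C1 -> D1))
    (H : N -> N') :
    injective H -> (forall u v : N,
      adjacent (val u) (val v) <-> adjacent (val (H u)) (val (H v))) ->
    exists f : hom_complex N -> hom_complex N', forall s,
      dim (val (f s)) = dim (val s) /\
      forall u : N, vertices (val (f s)) (val (H u)) <-> vertices (val s) (val u).
  move=> Hinj Hadj.
  suff /choice[f fP] : forall s : hom_complex N, exists t : hom_complex N',
      dim (val t) = dim (val s) /\
      forall u : N, vertices (val t) (val (H u)) <-> vertices (val s) (val u).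
    by exists f.
  move=> s.
  have [t [tN tdim tV]] := graph_isomorphic_cell Hinj Hadj (set_valP s).
  by exists (exist _ t (mem_set tN)).
have [f fP] := cell_map _ _ _ _ _ _ _ (can_inj FK) Fadj.
have [g gP] := cell_map _ _ _ _ _ _ _ (can_inj GK) Gadj.
have sub_vertices (C D : Type) (N : set (C -> D)) (s t : hom_complex N) :
    face (val t) (val s) <->
    forall u : N, vertices (val t) (val u) -> vertices (val s) (val u).
  rewrite face_vertices; split=> [ts u|ts v tv]; first exact: ts.
  have Nv : v \in N by apply/mem_set/(set_valP t).
  exact: (ts (exist _ v Nv)).
have eqc (C D : Type) (N : set (C -> D)) (s t : hom_complex N) :
    (forall u : N, vertices (val t) (val u) <-> vertices (val s) (val u)) ->
    t = s.
  move=> ts; apply/val_inj/eq_cell/seteqP; split.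
    by apply/face_vertices/sub_vertices => u /ts.
  by apply/face_vertices/sub_vertices => u /ts.
exists f; split=> [|s t|s]; last by have [] := fP s.
  exists g => s; apply: eqc => u.
    by have [_ gs] := gP (f s); rewrite -{1}(FK u) gs; have [_ ->] := fP s.
  by have [_ fs] := fP (g s); rewrite -{1}(GK u) fs; have [_ ->] := gP s.
have [_ fs] := fP s; have [_ ft] := fP t.
rewrite !sub_vertices; split=> ts u; last by rewrite -fs -ft; exact: ts.
by rewrite -(GK u) fs ft; exact: ts.
Qed.

(** * Full subcomplexes of the 1-skeleton and the three claims *)

Lemma full_subcomplex_skeleton {A B : Type} (M : set (A -> B))
    (X : set (cell A B)) :
  full_subcomplex X (skeleton 1 (hom_complex M)) ->
  exists N, N `<=` M /\ X = skeleton 1 (hom_complex N).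
Proof.
case=> XM Xface Xfull.
(* [N] collects the vertices of all cells of [X]; fullness then returns every cell of dimension at
   most 1 with vertices in [N]. *)
pose N : set (A -> B) := fun phi => exists2 s, X s & vertices s phi.
have NM : N `<=` M.
  by move=> phi [s /XM[/hom_complex_vertices sM _]]; exact: sM.
exists N; split=> //; apply/seteqP; split=> s.
  move=> Xs; have [_ s1] := XM _ Xs; split=> //.
  by apply/hom_complex_vertices => phi sphi; exists s.
case=> /hom_complex_vertices sN s1; apply: Xfull => [|t [ts]].
  by split=> //; apply/hom_complex_vertices; exact: (subset_trans sN).
rewrite leqn0 => /eqP/dim_eq0[phi tV].
have /sN[q Xq qphi] : vertices s phi.
  by apply: (iffLR (face_vertices _ _) ts); rewrite tV.
by apply: (Xface q Xq); apply/face_vertices; rewrite tV => _ ->.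
Qed.

Theorem proposition2p2p2 :
  (* isomorphic 1-skeletons imply isomorphic complexes *)
  (forall (A B A' B' : Type) (M : set (A -> B)) (M' : set (A' -> B')),
     isomorphic (skeleton 1 (hom_complex M)) (skeleton 1 (hom_complex M')) ->
     isomorphic (hom_complex M) (hom_complex M')) /\
  (* a product of simplices in C(A, B) whose 1-skeleton is in the 1-skeleton
     of the complex belongs to the complex *)
  (forall (A B : Type) (M : set (A -> B)) (s : cell A B),
     skeleton 1 (faces s) `<=` skeleton 1 (hom_complex M) ->
     hom_complex M s) /\
  (* the same for an abstract product of simplices p, whose 1-skeleton is
     found, up to isomorphism, as a full subcomplex X *)
  (forall (A B A' B' : Type) (M : set (A -> B)) (p : cell A' B')
          (X : set (cell A B)),
     full_subcomplex X (skeleton 1 (hom_complex M)) ->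
     isomorphic (skeleton 1 (faces p)) X ->
     exists s : cell A B,
       [/\ hom_complex M s, skeleton 1 (faces s) = X
         & isomorphic (faces p) (faces s)]).

Proof.
split; [|split].
- move=> A B A' B' M M' /skeleton_isomorphic_graph.
  exact: graph_isomorphic_complex.
- move=> A B M s sM; apply/hom_complex_vertices => phi sphi.
  (* The 1-skeleton of [s] already contains each vertex of [s] as a cell, and membership in
     [hom_complex M] depends on vertices only. *)
  have [t [tV t0]] := exists_vertex_cell phi.
  have [|/hom_complex_vertices tM _] := sM t; last by apply: tM; rewrite tV.
  split; last by rewrite t0.
  by apply/face_vertices; rewrite tV => _ ->.
- move=> A B A' B' M p X /full_subcomplex_skeleton[N [NM ->]].
  rewrite faces_hom_complex => /skeleton_isomorphic_graph pN.
  have [F [[G FK GK] Fadj]] := pN.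
  have [s [/hom_complex_vertices sN _ sF]] :=
    graph_isomorphic_cell (can_inj FK) Fadj
      (iffRL (hom_complex_vertices _ _) (@subset_refl _ (vertices p))).
  (* Since [F] is onto [N], the image cell of [p] has all of [N] as its vertex set, so its faces
     form [hom_complex N]. *)
  have sV : vertices s = N.
    apply/seteqP; split=> // phi Nphi.
    have := sF (G (exist _ phi (mem_set Nphi))); rewrite GK /= => ->.
    exact: set_valP.
  exists s; rewrite faces_hom_complex sV; split=> //.
    by apply/hom_complex_vertices; rewrite sV.
  exact: graph_isomorphic_complex.
Qed.
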